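(* Let $0<\alpha\le 1$, let $p,q,r>0$ be real constants with $q>p$, and consider the fractional order Mackey-Glass equation $$D^\alpha x(t)=-p\,x(t)+q\,\frac{x(t-\tau)}{1+x(t-\tau)^r},\qquad t>0.$$ Let $x_2^*=\left(\frac{q-p}{p}\right)^{1/r}$ be its nonzero equilibrium point. If $\frac{p}{q}>1-\frac{2}{r}$, then $x_2^*$ is asymptotically stable for every delay $\tau\ge 0$.
   Context: For $0<\alpha<1$, $D^\alpha$ is the Caputo derivative $D^\alpha f(t)=\frac{1}{\Gamma(1-\alpha)}\int_0^t (t-s)^{-\alpha}f'(s)\,ds$, and $D^1f=f'$. The equation is posed with initial data $x(t)=\phi(t)$ for $-\tau\le t\le 0$, where $\phi:[-\tau,0]\to\mathbb{R}$; the solution is denoted $x(t,\phi)$ and $\|\phi\|=\sup_{-\tau\le t\le 0}|\phi(t)|$. When $r$ is not an integer, $x^r$ is the usual real power and the equation is considered where it is defined. The notation $x_2^*=\left(\frac{q-p}{p}\right)^{1/r}$ stands for any real equilibrium with $(x_2^* )^r=\frac{q-p}{p}$ (the positive root, and for even integer $r$ also its negative). An equilibrium point $x_*$ (a constant solution) is stable if for every $\epsilon>0$ there is $\delta>0$ such that $\|\phi-x_*\|<\delta$ implies $|x(t,\phi)-x_*|<\epsilon$ for all $t\ge 0$. It is asymptotically stable if it is stable and there is $b_0>0$ such that $\|\phi-x_*\|<b_0$ implies $\lim_{t\to\infty}x(t,\phi)=x_*$. *)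

(* Defs.v *)
From HB Require Import structures.
From mathcomp Require Import all_boot all_order all_algebra.
From mathcomp Require Import archimedean.
From mathcomp Require Import all_classical all_reals all_analysis.

Set Implicit Arguments.
Unset Strict Implicit.
Unset Printing Implicit Defensive.

Import Order.TTheory GRing.Theory Num.Theory.
Import numFieldNormedType.Exports.

Local Open Scope classical_set_scope.
Local Open Scope ring_scope.

Section MackeyGlass.
Context {R : realType}.
Implicit Types (alpha p q r tau : R) (phi x : R -> R) (xs y t z : R).

Local Notation mu := (@lebesgue_measure R).

Definition Gamma z : R :=
  \int[mu]_(s in `]0, +oo[) (s `^ (z - 1) * expR (- s)).

(** [x] is absolutely continuous on [[0, t]], in the form that the Caputo
    integrand needs: [x] is there the primitive of its derivative.  Where [x]
    is not derivable, [derive1 x] has an arbitrary value; such points form a null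
    set because [x] is a primitive of an integrable function. *)
Definition abs_continuous x t : Prop :=
  mu.-integrable `[0, t] (EFin \o derive1 x) /\
  forall s, 0 <= s <= t -> x s = x 0 + \int[mu]_(u in `[0, s]) derive1 x u.

Definition caputo_kernel alpha x t : R -> R :=
  fun s => (t - s) `^ (- alpha) * derive1 x s.

(** The derivative of order [alpha], for [0 < alpha <= 1]. *)
Definition caputo alpha x t : R :=
  if alpha == 1 then derive1 x t
  else (Gamma (1 - alpha))^-1 * \int[mu]_(s in `[0, t]) caputo_kernel alpha x t s.

(** The value [caputo alpha x t] is meaningful: integrals and derivatives are
    total in the library. *)
Definition caputo_derivable alpha x t : Prop :=
  if alpha == 1 then derivable x t 1
  else abs_continuous x t /\
       mu.-integrable `[0, t] (EFin \o caputo_kernel alpha x t).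

(** [y ^ r] for a positive real [r]: the algebraic power for integer [r], at
    every real [y]; otherwise the real power, for [0 <= y] only. *)
Definition rpow y r : R :=
  if r \is a Num.nat then y ^+ Num.truncn r else y `^ r.

Definition rpow_defined y r : Prop := r \is a Num.nat \/ 0 <= y.

Definition mg_defined r y : Prop := rpow_defined y r /\ 1 + rpow y r != 0.

(** The value of [phi] matters on [[- tau, 0]] only, and that of [x] on
    [[- tau, +oo[]. *)
Record is_solution alpha p q r tau phi x : Prop := {
  sol_init : forall t, - tau <= t <= 0 -> x t = phi t ;
  sol_continuous : {within `[0, +oo[, continuous x} ;
  sol_defined : forall t, 0 < t -> mg_defined r (x (t - tau)) ;
  sol_derivable : forall t, 0 < t -> caputo_derivable alpha x t ;
  sol_eq : forall t, 0 < t ->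
    caputo alpha x t = - p * x t + q * (x (t - tau) / (1 + rpow (x (t - tau)) r))
}.

(** Extended-real valued, so that it is [+oo] for unbounded functions. *)
Definition history_norm tau phi : \bar R :=
  ereal_sup [set `|phi t|%:E | t in `[- tau, 0]].

Definition is_equilibrium alpha p q r tau xs : Prop :=
  is_solution alpha p q r tau (cst xs) (cst xs).

Definition stable alpha p q r tau xs : Prop :=
  forall e : R, 0 < e -> exists2 d : R, 0 < d &
    forall phi x, is_solution alpha p q r tau phi x ->
      (history_norm tau (fun t => (phi t - xs)%R) < d%:E)%E ->
      forall t, 0 <= t -> `|x t - xs| < e.

Definition asymptotically_stable alpha p q r tau xs : Prop :=
  [/\ is_equilibrium alpha p q r tau xs,
      stable alpha p q r tau xs &
      exists2 b : R, 0 < b &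
        forall phi x, is_solution alpha p q r tau phi x ->
          (history_norm tau (fun t => (phi t - xs)%R) < b%:E)%E ->
          x t @[t --> +oo] --> xs].

End MackeyGlass.

(* Main.v *)
Require Import Defs.
From mathcomp Require Import all_boot all_order all_algebra.
From mathcomp Require Import zify ring lra.
From mathcomp Require Import all_classical all_reals all_analysis measurable_realfun.

(** A first touching argument.  Near [xs] the delayed term
    [q * (y / (1 + y ^ r))] is Lipschitz with a constant [kap < p], because the
    hypothesis on [p / q] bounds its derivative [p * (1 - r * (1 - p / q))] by [p]
    in absolute value.  Compare [`|x t - xs|] with the barrier
    [W t = e - k * min t L], which decreases linearly from [e] to an arbitrary
    [eta > 0] at time [L] and is constant afterwards, so that
    [k = (e - eta) / L].  At a first time [T] with [`|x T - xs| = W T], the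
    derivative of [`|x - xs|] is at least that of [W], hence at least
    [- C * k * L ^ (1 - alpha)]; but the equation bounds it above by
    [- (p - kap) * eta + kap * k * tau].  For large [L] this is a contradiction.
    Thus [`|x t - xs| < W t] for all [t], which gives stability and convergence
    together.

    The comparison of the Caputo derivatives uses that the kernel
    [(T - s) ^ (- alpha)] increases in [s]: it is a limit of nonnegative
    combinations of indicators of [[s, T]], on which the derivative of
    [`|x - xs| - W] has a nonnegative integral, since that function vanishes at [T]
    and is nonpositive before. *)

Import Order.TTheory GRing.Theory Num.Theory.
Import numFieldNormedType.Exports.

Local Open Scope classical_set_scope.
Local Open Scope ring_scope.

(** * The Abel kernel and its integral *)

Lemma measurable_abel_kernel {R : realType} (a m : R) (D : set R) :
  measurable_fun D (fun s : R => (m - s) `^ a).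
Proof.
apply: measurable_funTS.
exact: (measurableT_comp (measurable_powR a) (measurable_funB _ _)).
Qed.

Lemma is_derive_abel_kernel {R : realType} (b m s : R) : s < m ->
  is_derive s 1 (fun z : R => (m - z) `^ b) (- (b * (m - s) `^ (b - 1))).
Proof.
move=> sm; have ms : 0 < m - s by rewrite subr_gt0.
have dB : is_derive s 1 (fun z : R => m - z) (-1).
  by apply: (is_derive_eq (is_deriveB _ _)); rewrite sub0r.
rewrite -[X in is_derive _ _ _ X]mulrN1.
exact: (@is_derive1_comp R (@powR R ^~ b) (fun z => m - z) _ _ _
  (is_derive1_powR b ms) dB).
Qed.

(** The kernel may be singular at [m], so the antiderivative [G] is used on the intervals [F n],
    which exhaust [[0, m[], and monotone convergence gives the limit. *)
Lemma integral_abel_kernel_le {R : realType} (a m : R) : 0 < m -> a < 1 ->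
  (\int[@lebesgue_measure R]_(s in `[0%R, m]) ((m - s) `^ (- a))%:E <=
    (m `^ (1 - a) / (1 - a))%:E)%E.
Proof.
move=> m0 a1.
have b0 : 0 < 1 - a by rewrite subr_gt0.
(* With [n.+2] the right endpoint is positive already for [n = 0]. *)
pose F n : set R := `[0, m - m / n.+2%:R]%classic.
pose G (s : R) := - (1 - a)^-1 * (m - s) `^ (1 - a).
have mf D : measurable_fun D (fun s : R => ((m - s) `^ (- a))%:E).
  by apply/measurable_EFinP; exact: measurable_abel_kernel.
have f0 (s : R) : (0 <= ((m - s) `^ (- a))%:E)%E by rewrite lee_fin powR_ge0.
have Fm n : 0 < m - m / n.+2%:R < m.
  rewrite subr_gt0 ltrBlDr ltrDl divr_gt0// andbT.
  by rewrite ltr_pdivrMr// ltr_pMr// ltr1n.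
have dG (s : R) : s < m -> is_derive s 1 G ((m - s) `^ (- a)).
  move=> sm; have dc := is_derive_abel_kernel (1 - a) _ _ sm.
  apply: (is_derive_eq (is_deriveZ (- (1 - a)^-1) dc)).
  rewrite /GRing.scale/= (_ : 1 - a - 1 = - a); last by ring.
  by field; rewrite gt_eqF.
have cG (s : R) : s < m -> {for s, continuous G}.
  by move=> /dG[d _]; apply/differentiable_continuous/derivable1_diffP.
have FE n : (\int[lebesgue_measure]_(s in F n) ((m - s) `^ (- a))%:E <=
    (m `^ (1 - a) / (1 - a))%:E)%E.
  have /andP[c0 cm] := Fm n.
  rewrite (@continuous_FTC2 _ (fun s => (m - s) `^ (- a)) G)//.
  - rewrite -EFinB lee_fin /G subr0 !mulNr opprK addrC mulrC lerBlDr lerDl.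
    by rewrite mulr_ge0 ?powR_ge0// invr_ge0 ltW.
  - apply: derivable_within_continuous => s; rewrite in_itv/= => /andP[_ sc].
    have sm := le_lt_trans sc cm.
    by have [] := is_derive_abel_kernel (- a) _ _ sm.
  - split.
    + move=> s; rewrite in_itv/= => /andP[_ sc].
      by have [] := dG _ (lt_trans sc cm).
    + by apply: cvg_at_right_filter; exact: cG.
    + by apply: cvg_at_left_filter; exact: cG.
  - move=> s; rewrite in_itv/= => /andP[_ sc]; rewrite derive1E.
    by have [_ ->] := dG _ (lt_trans sc cm).
have nF : nondecreasing_seq F.
  move=> i j ij; rewrite subsetEset; apply: subset_itvl; rewrite bnd_simp.
  by rewrite lerD2l lerN2 ler_pM2l// lef_pV2 ?posrE ?ltr0n// ler_nat !ltnS.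
have cF : (\int[lebesgue_measure]_(s in F i) ((m - s) `^ (- a))%:E)%E @[i --> \oo]
    --> (\int[lebesgue_measure]_(s in \bigcup_i F i) ((m - s) `^ (- a))%:E)%E.
  apply: ge0_nondecreasing_set_cvg_integral => //.
  - by move=> i; exact: measurable_itv.
  - by move=> i; exact: mf.
rewrite -integral_itv_bndo_bndc//.
have -> : `[0, m[%classic = \bigcup_i F i.
  apply/seteqP; split => s /=; rewrite in_itv/=; last first.
    by case=> n _; rewrite /F/= in_itv/= => /andP[-> /le_lt_trans->//]; have /andP[] := Fm n.
  move=> /andP[s0 sm].
  (* A point [s] of [[0, m[] lies in [F n] exactly when [m / (m - s) <= n + 2]. *)
  exists (Num.truncn (m / (m - s))) => //; rewrite /F/= in_itv/= s0/=.
  rewrite lerBrDr -lerBrDl ler_pdivrMr// mulrC -ler_pdivrMr ?subr_gt0//.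
  have /ltW/le_trans := truncnS_gt (m / (m - s)); apply.
  by rewrite ler_nat.
rewrite -(cvg_lim _ cF)//; apply: lime_le; last by apply: nearW.
by apply/cvg_ex; eexists; exact: cF.
Qed.

Lemma integrable_abel_kernel {R : realType} (a m : R) : 0 < m -> a < 1 ->
  (@lebesgue_measure R).-integrable `[0, m] (EFin \o (fun s => (m - s) `^ (- a))).
Proof.
move=> m0 a1; apply/integrableP; split.
  by apply/measurable_EFinP; exact: measurable_abel_kernel.
under eq_integral do rewrite /= ger0_norm ?powR_ge0//.
by rewrite (le_lt_trans (integral_abel_kernel_le _ _ m0 a1)) ?ltry.
Qed.

Lemma Rintegral_abel_kernel_le {R : realType} (a m : R) : 0 < m -> a < 1 ->
  \int[@lebesgue_measure R]_(s in `[0, m]) (m - s) `^ (- a) <=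
  m `^ (1 - a) / (1 - a).
Proof.
move=> m0 a1; rewrite -lee_fin fineK ?integral_abel_kernel_le//.
exact/integrable_fin_num/integrable_abel_kernel.
Qed.

(** * Rounding down to multiples of [1 / n] *)

Lemma cvg_truncn_div {R : realType} (c : R) : 0 <= c ->
  (Num.truncn (c * n%:R))%:R / n%:R @[n --> \oo] --> c.
Proof.
move=> c0.
apply: (@squeeze_cvgr _ _ _ _ (fun n : nat => c - n%:R^-1) (fun=> c)).
- near=> n.
  have n0 : 0 < n%:R :> R by rewrite ltr0n; near: n; exists 1%N.
  have cn : 0 <= c * n%:R by rewrite mulr_ge0// ltW.
  have /andP[h1 h2] := truncn_itv cn.
  rewrite ler_pdivrMr// h1 andbT ler_pdivlMr// mulrBl mulVf ?gt_eqF//.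
  by rewrite lerBlDr natr1 ltW.
- rewrite -[X in _ --> X]subr0; apply: cvgB; first exact: cvg_cst.
  rewrite -(@cvg_shiftS R).
  exact: cvg_harmonic.
- exact: cvg_cst.
Unshelve. all: by end_near. Qed.

(** Serves to evaluate a sum of indicators of superlevel sets as a truncation, capped at the number
    [N] of levels. *)
Lemma sum_nat_le_truncn {R : realType} (c : R) N : 0 <= c ->
  (\sum_(k < N) (k.+1%:R <= c :> R))%N = minn N (Num.truncn c).
Proof.
move=> c0; under eq_bigr do rewrite -truncn_ge_nat//.
elim: N => [|N IH]; first by rewrite big_ord0 min0n.
rewrite big_ord_recr/= IH; case: leqP => h; rewrite /minn; case: ltnP; case: ltnP; lia.
Qed.

(** * The power and the delayed term near the equilibrium *)

Lemma rpow_pos {R : realType} (y r : R) : 0 < y -> rpow y r = y `^ r.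
Proof.
move=> y0; rewrite /rpow; case: ifPn => // /natrP[n ->].
by rewrite natrK powR_mulrn// ltW.
Qed.

Lemma rpow0 {R : realType} (r : R) : 0 < r -> rpow 0 r = 0.
Proof.
rewrite /rpow; case: ifPn => [/natrP[n ->]|_] r0; last by rewrite powR0// gt_eqF.
by move: r0; rewrite natrK ltr0n expr0n => n0; rewrite gtn_eqF.
Qed.

(** Dividing by [y] instead of lowering the exponent gives one formula for both branches of [rpow],
    including negative [y] when [r] is an integer. *)
Lemma is_derive_rpow {R : realType} (y r : R) : 0 < r -> rpow_defined y r ->
  rpow y r != 0 -> is_derive y 1 (rpow ^~ r) (r * rpow y r / y).
Proof.
move=> r0 [rnat|y0] ry0; last first.
  have {y0} y0 : 0 < y.
    by rewrite lt_neqAle y0 andbT eq_sym; apply: contra ry0 => /eqP ->; rewrite rpow0.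
  have -> : r * rpow y r / y = r * y `^ (r - 1).
    rewrite rpow_pos// -(mulr_powRB1 (ltW y0) r0).
    by field; rewrite gt_eqF.
  apply: (near_eq_is_derive _ (is_derive1_powR r y0)).
  near=> z; rewrite rpow_pos//; near: z; exact: lt_nbhsr.
have /natrP[n rn] := rnat; rewrite rn in r0 ry0 *.
rewrite ltr0n in r0.
have rpE (z : R) : rpow z n%:R = z ^+ n by rewrite /rpow natr_nat natrK.
rewrite (_ : rpow ^~ _ = (fun z => z ^+ n)); last by apply/funext.
rewrite rpE in ry0 *.
have y0 : y != 0 by apply: contra ry0 => /eqP ->; rewrite expr0n gtn_eqF.
have := is_deriveX n (is_derive_id y 1); rewrite exprfctE => /is_derive_eq; apply.
case: n {rn ry0 rpE} r0 => // n _.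
by rewrite /GRing.scale/= mulr1 exprS; field.
Unshelve. all: by end_near. Qed.

(* The constant is any number between [p * `|1 - r * (1 - p / q)|] and [p]. *)
Lemma mg_feedback_lipschitz {R : realType} (p q r xs : R) :
  0 < p -> p < q -> 0 < r -> rpow_defined xs r -> rpow xs r = (q - p) / p ->
  1 - 2 / r < p / q ->
  exists k : R, exists2 d : R, 0 < d & 0 <= k < p /\ forall y, `|y - xs| < d ->
    `|q * (y / (1 + rpow y r)) - p * xs| <= k * `|y - xs|.
Proof.
move=> p0 pq r0 xsd xsr hpq.
have q0 : 0 < q by apply: lt_trans pq.
have xr0 : rpow xs r != 0 by rewrite xsr mulf_neq0 ?invr_eq0 ?gt_eqF ?subr_gt0.
have x0 : xs != 0 by apply: contra xr0 => /eqP ->; rewrite rpow0.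
(* The derivative of [g] at [xs], simplified by [1 + rpow xs r = q / p]. *)
pose c := p * (1 - r * (1 - p / q)).
have dr := is_derive_rpow _ _ r0 xsd xr0.
pose g y := q * (y / (1 + rpow y r)).
have g1 : 1 + rpow xs r = q / p by rewrite xsr; field; rewrite gt_eqF.
have gxs : g xs = p * xs.
  by rewrite /g g1; field; rewrite !gt_eqF.
have dg : is_derive xs 1 g c.
  have dD : is_derive xs 1 (fun z => 1 + rpow z r) (r * rpow xs r / xs).
    by apply: (is_derive_eq (is_deriveD _ dr)); rewrite add0r.
  have g0 : 1 + rpow xs r != 0 by rewrite g1 mulf_neq0 ?invr_eq0 ?gt_eqF.
  have dV : is_derive xs 1 (fun z => (1 + rpow z r)^-1)
      (- (1 + rpow xs r) ^- 2 * (r * rpow xs r / xs)).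
    apply: DeriveDef; first by apply: derivableV => //; case: dD.
    by rewrite deriveV//; case: dD => _ ->.
  apply: (is_derive_eq (is_deriveZ q (is_deriveM (is_derive_id xs 1) dV))).
  rewrite /GRing.scale/= g1 xsr /c; field.
  by rewrite x0 (gt_eqF p0) (gt_eqF q0).
(* By [p < q] and the hypothesis on [p / q], the number [r * (1 - p / q)] lies strictly between 0
   and 2. *)
have cp : `|c| < p.
  have qp : 0 < 1 - p / q by rewrite subr_gt0 ltr_pdivrMr ?mul1r.
  have h : r * (1 - p / q) < 2 by rewrite mulrC -ltr_pdivlMr//; lra.
  rewrite /c normrM gtr0_norm// gtr_pMr// ltr_norml.
  have := mulr_gt0 r0 qp; lra.
(* The gap between [|c|] and [k] is the error allowed for the difference quotient of [g] at [xs]. *)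
have [k /andP[ck kp]] : exists k, `|c| < k < p by exists ((`|c| + p) / 2); lra.
have [dx dv] := dg.
move: dx => /cvg_ex[l] gl; have lc : l = c by rewrite -dv; apply/esym/cvg_lim.
move: gl; rewrite lc => /cvgrPdist_lt/(_ (k - `|c|)); rewrite subr_gt0 => /(_ ck).
case=> d /= d0 gd; exists k, d => //; split.
  by rewrite kp (le_trans _ (ltW ck)).
move=> y yd; rewrite -/(g y) -gxs.
have [->|yx] := eqVneq y xs; first by rewrite !subrr normr0 mulr0.
have yx0 : y - xs != 0 by rewrite subr_eq0.
have := gd (y - xs); rewrite /= sub0r normrN => /(_ yd yx0).
rewrite /GRing.scale/= mulr1 subrK => h.
rewrite -[g y - g xs](mulVKf yx0) normrM mulrC ler_wpM2r//.
have := ler_normB c (c - (y - xs)^-1 * (g y - g xs)).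
rewrite opprB addrC subrK; lra.
Qed.

(** * Integration against the increasing kernel *)

(** The decreasing map with exponent [- a] has the map with exponent [- a^-1] as inverse on the
    positive reals. This identifies the superlevel sets of the kernel as intervals. *)
Lemma powRV_swap {R : realType} (a c y : R) : 0 < a -> 0 < c -> 0 < y ->
  (c <= y `^ (- a)) = (y <= c `^ (- a^-1)).
Proof.
move=> a0 c0 y0.
have swap (b u v : R) : 0 < b -> 0 < u -> 0 < v ->
    u <= v `^ (- b) -> v <= u `^ (- b^-1).
  move=> b0 u0 v0 uv.
  have vb : v `^ b <= u^-1.
    by rewrite -[leLHS]invrK -powRN lef_pV2 ?posrE ?powR_gt0.
  rewrite -[leLHS](powRr1 (ltW v0)) -(mulfV (lt0r_neq0 b0)) powRrM.
  rewrite -[- b^-1]mulN1r powRrM powR_inv1 ?(ltW u0)//.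
  by rewrite ge0_ler_powR ?nnegrE ?invr_ge0 ?powR_ge0 ?(ltW b0) ?(ltW u0).
apply/idP/idP => h; first exact: swap.
rewrite -[a in - a]invrK; apply: swap => //.
by rewrite invr_gt0.
Qed.

Local Notation mu := lebesgue_measure.

Lemma integrable_subitv {R : realType} (i j : interval R) (f : R -> \bar R) :
  [set` i] `<=` [set` j] -> mu.-integrable [set` j] f -> mu.-integrable [set` i] f.
Proof. by move=> ij; apply: integrableS => //; exact: measurable_itv. Qed.

(** A layer-cake argument. As [h] may change sign, the limit is taken by dominated convergence:
    rounding the kernel down keeps the approximations below [|K * h|]. *)
Lemma Rintegral_abel_kernel_ge0 {R : realType} (a T : R) (h : R -> R) :
  0 < a -> 0 < T -> mu.-integrable `[0, T] (EFin \o h) ->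
  mu.-integrable `[0, T] (EFin \o (fun s => (T - s) `^ (- a) * h s)) ->
  (forall s, 0 <= s <= T -> 0 <= \int[mu]_(u in `[s, T]) h u) ->
  0 <= \int[mu]_(s in `[0, T]) ((T - s) `^ (- a) * h s).
Proof.
move=> a0 T0 ih iKh hge0.
pose K s := (T - s) `^ (- a).
(* [A c] is the superlevel set of [K] at level [c > 0]. *)
pose A c : set R := `[Num.max 0 (T - c `^ (- a^-1)), T[%classic.
(* There are [n * n] levels with spacing [1 / n], so they reach height [n]: both the mesh and the
   cap on the unbounded kernel are removed in the limit. *)
pose F n (s : R) : \bar R := (\sum_(k < n * n) (n%:R^-1)%:E * ((EFin \o h) \_ (A (k.+1%:R / n%:R)%R)) s)%E.
have mA c : measurable (A c) by exact: measurable_itv.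
have mD : measurable (`[0, T]%classic : set R) by exact: measurable_itv.
have AD c : A c `<=` `[0, T].
  move=> s; rewrite /A/= !in_itv/= => /andP[+ /ltW ->].
  by rewrite ge_max andbT => /andP[].
have KA c s : 0 < c -> 0 <= s <= T -> (s \in A c) = (c <= K s).
  move=> c0 /andP[s0 sT]; rewrite /A mem_setE in_itv/= ge_max s0/=.
  have [sTl|] := ltP s T; last first.
    (* At [s = T] the kernel takes the default value 0, so [T] is in no superlevel set. *)
    move=> Ts; rewrite andbF /K (_ : T - s = 0).
      by rewrite powR0 ?oppr_eq0 ?gt_eqF// leNgt c0.
    by apply/eqP; rewrite subr_eq0 eq_le Ts.
  by rewrite andbT /K powRV_swap ?subr_gt0// lerBlDr addrC -lerBlDr.
have iA c : mu.-integrable `[0, T] ((EFin \o h) \_ (A c)).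
  have [+ _] := integrable_restrict lebesgue_measure (mA c) mD (EFin \o h); apply.
  by rewrite setIidr//; apply: integrable_subitv ih; exact: AD.
have Age0 c : 0 < c -> (0 <= \int[mu]_(s in `[0%R, T]) ((EFin \o h) \_ (A c)) s)%E.
  move=> c0; rewrite -integral_mkcondr setIidr//.
  set b := Num.max 0 (T - c `^ (- a^-1)).
  have b0T : 0 <= b <= T.
    by rewrite /b le_max lexx/= ge_max ltW//= gerBl powR_ge0.
  have ibT : mu.-integrable `[b, T] (EFin \o h).
    apply: integrable_subitv ih.
    by apply: subset_itvr; rewrite bnd_simp; case/andP: b0T.
  rewrite integral_itv_bndo_bndc; last first.
    apply: (measurable_int lebesgue_measure); apply: integrable_subitv ibT.
    by apply: subset_itvl; rewrite bnd_simp.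
  have := hge0 b b0T; rewrite -lee_fin /Rintegral fineK//.
  exact: integrable_fin_num.
have FE n s : 0 <= s <= T ->
  F n s = ((minn (n * n) (Num.truncn (K s * n%:R)))%:R / n%:R * h s)%:E.
  move=> s0T; have K0 : 0 <= K s * n%:R by rewrite mulr_ge0 ?powR_ge0.
  rewrite -sum_nat_le_truncn// natr_sum mulr_suml mulr_suml -sumEFin.
  apply: eq_bigr => -[k kn] _ /=; rewrite patchE.
  have n0 : 0 < n%:R :> R by rewrite ltr0n; case: n kn {K0}.
  rewrite KA//; last by rewrite divr_gt0// ltr0n.
  rewrite ler_pdivrMr//; case: ifP => _ /=; first by rewrite -EFinM mul1r.
  by rewrite mule0 mul0r mul0r.
have iF n : mu.-integrable `[0, T] (F n).
  by apply: integrable_sum => // k _; apply: integrableZl => //; exact: iA.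
have Fge0 n : (0 <= \int[mu]_(s in `[0%R, T]) F n s)%E.
  rewrite integral_sum//; last by move=> k; apply: integrableZl.
  apply: sume_ge0 => -[k kn] _.
  have n0 : 0 < n%:R :> R by rewrite ltr0n; case: n kn.
  rewrite integralZl// mule_ge0 ?lee_fin ?invr_ge0 ?(ltW n0)// Age0//.
  by rewrite divr_gt0// ltr0n.
have truncK n s : (Num.truncn (K s * n%:R))%:R <= K s * n%:R.
  by rewrite truncn_le mulr_ge0 ?powR_ge0.
have Kcvg s : (minn (n * n) (Num.truncn (K s * n%:R)))%:R / n%:R @[n --> \oo] --> K s.
  apply: cvg_trans (cvg_truncn_div (K s) (powR_ge0 (T - s) (- a))).
  (* Once [n] exceeds [K s], the cap [n * n] has no effect. *)
  apply: near_eq_cvg; near=> n; rewrite (minn_idPr _)//.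
  have Kn : K s <= n%:R by near: n; exact: nbhs_infty_ger.
  rewrite -(ler_nat R) (le_trans (truncK _ _))//.
  by rewrite natrM ler_wpM2r.
have Fcvg : (\int[mu]_(s in `[0%R, T]) F n s)%E @[n --> \oo] -->
    (\int[mu]_(s in `[0%R, T]) (K s * h s)%:E)%E.
  apply: (@dominated_cvg _ _ _ lebesgue_measure _ (measurable_itv _) F _
    (fun s => `|K s * h s|%:E)%E).
  - by move=> n; apply: (measurable_int lebesgue_measure); exact: iF.
  - move=> s; rewrite /= in_itv/= => s0T.
    under eq_fun do rewrite FE//.
    apply: cvg_EFin; first exact: nearW.
    by rewrite /comp/=; apply: cvgM; [exact: Kcvg|exact: cvg_cst].
  - by [].
  - exact: integrable_norm iKh.
  - move=> n s; rewrite /= in_itv/= => s0T.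
    rewrite FE// lee_fin !normrM ler_wpM2r//.
    rewrite !ger0_norm ?powR_ge0 ?divr_ge0 ?invr_ge0//.
    (* For [n = 0] the convention [0^-1 = 0] makes the coefficient vanish. *)
    have [->|n0] := posnP n; first by rewrite invr0 mulr0 powR_ge0.
    rewrite ler_pdivrMr ?ltr0n//.
    by rewrite (le_trans _ (truncK _ _))// ler_nat geq_minr.
rewrite /Rintegral fine_ge0// -(cvg_lim _ Fcvg)//; apply: lime_ge; last exact: nearW.
by apply/cvg_ex; eexists; exact: Fcvg.
Unshelve. all: by end_near. Qed.

(** * The Caputo derivative at a touching point *)

Lemma Gamma_ge0 {R : realType} (z : R) : 0 <= Gamma z.
Proof.
by apply: Rintegral_ge0 => s _; rewrite mulr_ge0 ?powR_ge0 ?expR_ge0.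
Qed.

Lemma Rintegral_indic_itv {R : realType} (m s T : R) :
  0 <= s <= m -> m <= T ->
  \int[mu]_(u in `[s, T]) \1_(`[0, m[%classic) u = m - s.
Proof.
move=> /andP[s0 sm] mT; rewrite /Rintegral integral_indic; [|exact: measurable_itv..].
rewrite (_ : _ `&` _ = `[s, m[%classic).
  have := @lebesgue_measure_itv R `[s, m[; rewrite /= lte_fin => msm.
  rewrite [X in fine X]msm; case: ltP => //= ms; apply/esym/eqP.
  by rewrite subr_eq0 eq_le ms sm.
apply/seteqP; split => u /=; rewrite !in_itv/=.
  by move=> [/andP[_ ->] /andP[-> _]].
move=> /andP[su um]; rewrite um su (le_trans s0 su)/=; split => //.
exact: ltW (lt_le_trans um mT).
Qed.

(** Replacing [T - s] by the smaller [m - s] only increases the kernel, whence a bound that does not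
    depend on [T]. *)
Lemma Rintegral_abel_kernel_trunc {R : realType} (a m T : R) : 0 <= a < 1 ->
  0 < m <= T ->
  \int[mu]_(s in `[0, T]) ((T - s) `^ (- a) * \1_(`[0, m[%classic) s) <=
  m `^ (1 - a) / (1 - a).
Proof.
move=> /andP[a0 a1] /andP[m0 mT].
have T0 : 0 < T by exact: lt_le_trans mT.
pose K (u s : R) := (u - s) `^ (- a).
have iK := integrable_abel_kernel _ _ T0 a1.
have im := integrable_abel_kernel _ _ m0 a1.
have sm : `[0, m[ `<=` `[0, m] by apply: subset_itvl; rewrite bnd_simp.
have sT : `[0, m[ `<=` `[0, T] by apply: subset_itvl; rewrite bnd_simp.
rewrite (le_trans _ (Rintegral_abel_kernel_le _ _ m0 a1))//.
rewrite -[leRHS]Rintegral_itv_bndo_bndc; last exact: integrable_subitv im.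
rewrite (_ : \int[mu]_(s in _) _ = \int[mu]_(s in `[0, m[) K T s); last first.
  rewrite -[in RHS](setIidr sT) Rintegral_mkcondr; apply: eq_Rintegral => s _.
  by rewrite patch_indic.
apply: le_Rintegral.
- exact: measurable_itv.
- exact: integrable_subitv iK.
- exact: integrable_subitv im.
move=> s; rewrite /= in_itv/= => /andP[s0 sltm].
have ms : 0 < m - s by rewrite subr_gt0.
rewrite /K !powRN lef_pV2 ?posrE ?powR_gt0 ?(lt_le_trans ms) ?lerB//.
have mTs : m - s <= T - s by rewrite lerB.
by apply: ge0_ler_powR => //; rewrite nnegrE ?(ltW ms)// (le_trans (ltW ms)).
Qed.

(* The hypothesis says that [sgm * x] touches [- k * min s L] (up to a constant)
   from below at [T]. *)
Lemma caputo_touch {R : realType} (alpha : R) : 0 < alpha <= 1 ->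
  exists2 C : R, 0 <= C & forall (x : R -> R) (sgm k L T : R),
    0 <= k -> 0 < L -> 0 < T -> caputo_derivable alpha x T ->
    (forall s, 0 <= s <= T ->
      - k * (Num.min T L - Num.min s L) <= sgm * (x T - x s)) ->
    - (k * C * L `^ (1 - alpha)) <= sgm * caputo alpha x T.
Proof.
move=> /andP[a0]; rewrite le_eqVlt /caputo_derivable /caputo => /predU1P[a1|a1].
  (* For [alpha = 1] the power of [L] is 1 and the bound is the slope [- k]. *)
  exists 1 => // x sgm k L T k0 L0 T0; rewrite a1 eqxx subrr powRr0 => dx xW.
  rewrite !mulr1 derive1E.
  have minD (u : R) : u < 0 -> Num.min T L + u <= Num.min (u + T) L.
    move=> u0; rewrite le_min [X in X <= _]addrC lerD2l ge_min lexx/=.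
    by rewrite -[X in _ <= X]addr0 lerD ?(ltW u0)// ge_min lexx orbT.
  (* The touching hypothesis concerns times up to [T] only, so the derivative is taken as a limit
     from the left. *)
  have dq : (fun h => sgm * (h^-1 *: (x (h *: 1 + T) - x T))) @ 0^'- --> sgm * 'D_1 x T.
    apply: cvgM; first exact: cvg_cst.
    by apply: cvg_dnbhs_at_left; exact: dx.
  rewrite -(cvg_lim _ dq)//; apply: limr_ge; first by apply/cvg_ex; eexists; exact: dq.
  near=> h.
  have h0 : h < 0 by near: h; exact: nbhs_left_lt.
  have hT : - T < h by near: h; apply: nbhs_left_gt; rewrite oppr_lt0.
  have := xW (h + T); rewrite /GRing.scale/= mulr1 => xWh.
  have {xWh} : k * h <= sgm * (x T - x (h + T)).
    apply: le_trans (xWh _); last by rewrite -lerBlDr sub0r ltW//= gerDr ltW.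
    rewrite mulNr -mulrN ler_wpM2l// opprB lerBrDl /=.
    exact: minD.
  move=> kh; rewrite (_ : sgm * _ = - (sgm * (x T - x (h + T)) / h)).
    by rewrite lerN2 ler_ndivrMr.
  by rewrite -mulNr -mulrN opprB [h^-1 * _]mulrC mulrA.
have b0 : 0 < 1 - alpha by rewrite subr_gt0.
have G0 : 0 <= (Gamma (1 - alpha))^-1 by rewrite invr_ge0 Gamma_ge0.
(* The first factor comes from the definition of [caputo], the second from the integral of the
   kernel. *)
exists ((Gamma (1 - alpha))^-1 / (1 - alpha)).
  by rewrite divr_ge0// ltW.
move=> x sgm k L T k0 L0 T0; rewrite (lt_eqF a1) => -[[ix xE] iKx] xW.
pose m := Num.min T L.
have m0T : 0 < m <= T by rewrite /m lt_min T0 L0 ge_min lexx.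
have [m0 mT] := andP m0T.
pose A : set R := `[0, m[%classic.
have mA : measurable A by exact: measurable_itv.
(* On [[0, T]] this is almost everywhere the derivative of [sgm * x s + k * min s L]; by [xW] its
   integral over each [[s, T]] is nonnegative. *)
pose h s := sgm * derive1 x s + k * \1_A s.
pose K s := (T - s) `^ (- alpha).
have mD : measurable (`[0, T]%classic : set R) by exact: measurable_itv.
have iA : mu.-integrable `[0, T] (EFin \o (\1_A : R -> R)).
  exact: integrableS (integrable_indic_itv 0 m true true).
have iKA : mu.-integrable `[0, T] (EFin \o (fun s => K s * \1_A s)).
  apply: le_integrable (integrable_abel_kernel _ _ T0 a1) => //.
    apply/measurable_EFinP; apply: measurable_funM; first exact: measurable_abel_kernel.
    exact: measurable_indic.
  move=> s _; rewrite /= lee_fin normrM ler_piMr// indicE.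
  by case: (s \in A); rewrite ?normr1 ?normr0.
have iKh' : mu.-integrable `[0, T] (EFin \o (fun s => sgm * caputo_kernel alpha x T s)).
  exact: integrableZl iKx.
have iKA' : mu.-integrable `[0, T] (EFin \o (fun s => k * (K s * \1_A s))).
  exact: integrableZl iKA.
have KhE s : (T - s) `^ (- alpha) * h s =
    sgm * caputo_kernel alpha x T s + k * (K s * \1_A s).
  by rewrite /h /K /caputo_kernel; ring.
have iKh : mu.-integrable `[0, T] (EFin \o (fun s => (T - s) `^ (- alpha) * h s)).
  rewrite (funext KhE); exact: integrableD iKh' iKA'.
have ix' : mu.-integrable `[0, T] (EFin \o (fun s => sgm * derive1 x s)).
  exact: integrableZl ix.
have iA' : mu.-integrable `[0, T] (EFin \o (fun s => k * \1_A s)).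
  exact: integrableZl iA.
have ih : mu.-integrable `[0, T] (EFin \o h) by exact: integrableD ix' iA'.
have h0 s : 0 <= s <= T -> 0 <= \int[mu]_(u in `[s, T]) h u.
  move=> /andP[s0 sT].
  have sub : `[s, T] `<=` `[0, T] by apply: subset_itvr; rewrite bnd_simp.
  have := integrable_subitv _ _ _ sub; rewrite /h => isub.
  rewrite RintegralD; [|exact: measurable_itv|exact: isub|exact: isub].
  rewrite !RintegralZl;
    [|exact: measurable_itv|exact: isub|exact: measurable_itv|exact: isub].
  have -> : \int[mu]_(u in `[s, T]) derive1 x u = x T - x s.
    rewrite -Rintegral_itv_obnd_cbnd; last first.
      by apply: integrable_subitv ix; apply: subset_itvr; rewrite bnd_simp.
    rewrite -(@Rintegral_itvB _ _ (BLeft 0)) ?bnd_simp//.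
    rewrite (xE T) ?lexx ?ltW// (xE s) ?s0//; ring.
  have := xW s; rewrite s0 sT => /(_ isT).
  have A0 : 0 <= \int[mu]_(u in `[s, T]) \1_A u by apply: Rintegral_ge0.
  have [sm|ms] := leP s m.
    rewrite Rintegral_indic_itv ?s0//.
    have -> : Num.min s L = s.
      by apply/min_idPl; rewrite (le_trans sm)// /m ge_min lexx orbT.
    by rewrite -/m; lra.
  (* Here [m < s <= T] forces [m = L]: the barrier is constant on [[s, T]]. *)
  have -> : Num.min s L = L.
    by apply/min_idPr; move: ms; rewrite /m gt_min ltNge sT/= => /ltW.
  have -> : Num.min T L = L.
    by apply/min_idPr; move: ms; rewrite /m gt_min ltNge sT/= => /ltW/le_trans; apply.
  by rewrite subrr mulr0 => xT0; rewrite addr_ge0// mulr_ge0.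
have := Rintegral_abel_kernel_ge0 alpha T h a0 T0 ih iKh h0.
under eq_Rintegral do rewrite KhE.
rewrite RintegralD// !RintegralZl//.
have : \int[mu]_(s in `[0, T]) (K s * \1_A s) <= L `^ (1 - alpha) / (1 - alpha).
  apply: le_trans (Rintegral_abel_kernel_trunc _ _ _ _ _) _ => //.
    by rewrite ltW.
  rewrite ler_pM2r ?invr_gt0// ge0_ler_powR ?nnegrE ?(ltW b0) ?(ltW m0) ?(ltW L0)//.
  by rewrite ge_min lexx orbT.
move: (\int[mu]_(s in _) _) (\int[mu]_(s in _) _) => I J JL IJ.
have kJ : k * J <= k * (L `^ (1 - alpha) / (1 - alpha)) by rewrite ler_wpM2l.
rewrite (_ : k * _ * _ = (Gamma (1 - alpha))^-1 * (k * (L `^ (1 - alpha) / (1 - alpha)))).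
  rewrite [X in _ <= X]mulrCA -mulrN ler_wpM2l// lerNl (le_trans _ kJ)//.
  by rewrite -subr_ge0 opprK addrC.
by ring.
Unshelve. all: by end_near. Qed.

(** * The first touching time and the barrier *)

Lemma first_zero {R : realType} (f : R -> R) :
  {within `[0, +oo[, continuous f} -> f 0 < 0 ->
  (exists2 t, 0 <= t & 0 <= f t) ->
  exists2 T, 0 < T & f T = 0 /\ forall s, 0 <= s < T -> f s < 0.
Proof.
move=> /continuous_within_itvcyP[cf cf0] f0 [t t0 ft].
pose S : set R := [set s | 0 <= s /\ 0 <= f s].
have infS : has_inf S by split; [exists t|exists 0 => s []].
have S_lb s : S s -> inf S <= s by apply: inf_lbound; case: infS.
have adh e : 0 < e -> exists2 s, S s & s < inf S + e by move=> e0; exact: inf_adherent.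
have ltS s : 0 <= s < inf S -> f s < 0.
  move=> /andP[s0 sS]; rewrite ltNge; apply/negP => fs.
  by have := S_lb s (conj s0 fs); rewrite leNgt sS.
have S0 : 0 <= inf S by apply: lb_le_inf; [exists t|move=> s []].
(* By right continuity [f] stays negative near 0. *)
have {S0} S0 : 0 < inf S.
  rewrite lt_neqAle S0 andbT; apply/negP => /eqP S00.
  have [d /= d0 fd] := cvgr_lt _ cf0 _ f0.
  have [s [s0 fs]] := adh d d0; rewrite -S00 add0r => sd.
  have [s00|s00] := eqVneq s 0; first by move: fs; rewrite s00 leNgt f0.
  have := fd s; rewrite /= sub0r normrN ger0_norm// => /(_ sd).
  by rewrite lt_neqAle eq_sym s00 s0 => /(_ isT); rewrite ltNge fs.
have cT : {for inf S, continuous f} by apply: cf; rewrite in_itv/= S0.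
exists (inf S) => //; split; last exact: ltS.
(* A negative value would persist to the right, against points of [S] close to its infimum; a
   positive one would persist to the left, against [ltS]. *)
have [fT|fT|//] := ltgtP (f (inf S)) 0.
  have [d /= d0 fd] := cvgr_lt _ cT _ fT.
  have [s [s0 fs] sd] := adh d d0.
  have := fd s; rewrite /= ler0_norm ?subr_le0 ?S_lb// opprB ltrBlDl => /(_ sd).
  by rewrite ltNge fs.
have [d /= d0 fd] := cvgr_gt _ cT _ fT.
pose s := Num.max 0 (inf S - d / 2).
have sS : 0 <= s < inf S.
  by rewrite /s le_max lexx/= gt_max S0/= ltrBlDr ltrDl divr_gt0.
have := ltS s sS; rewrite ltNge => /negP; case; apply/ltW/fd.
have /andP[_ sS'] := sS.
rewrite /= gtr0_norm ?subr_gt0// ltrBlDr -ltrBlDl.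
by rewrite /s lt_max; apply/orP; right; lra.
Qed.

(** In the application, the term in [A] comes from the Caputo derivative of the barrier and the term
    in [B] from the fall of the barrier over one delay. *)
Lemma barrier_slope_small {R : realType} (alpha A B d : R) :
  0 < alpha <= 1 -> 0 <= A -> 0 <= B -> 0 < d ->
  exists2 L, 0 < L & A * L `^ (- alpha) + B / L < d.
Proof.
move=> /andP[a0 a1] A0 B0 d0.
(* The summand 1 makes the final inequality strict and gives [1 <= c], so that [L = c ^ (1 / alpha)]
   is at least [c]. *)
pose c := (A + B) / d + 1.
have c1 : 1 <= c by rewrite /c lerDr divr_ge0 ?addr_ge0 ?(ltW d0).
have c0 : 0 < c by apply: lt_le_trans c1.
exists (c `^ alpha^-1); first exact: powR_gt0.
have Lc : (c `^ alpha^-1) `^ (- alpha) = c^-1.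
  by rewrite -powRrM mulrN mulVf ?gt_eqF// powR_inv1 ?ltW.
have cL : (c `^ alpha^-1)^-1 <= c^-1.
  rewrite lef_pV2 ?posrE ?powR_gt0// -[leLHS]powRr1 ?(ltW c0)//.
  by rewrite ler_powR// invf_ge1.
rewrite Lc; apply: (@le_lt_trans _ _ ((A + B) / c)).
  by rewrite mulrDl lerD2l ler_wpM2l.
rewrite ltr_pdivrMr// /c mulrDr mulr1 mulrCA mulfV ?gt_eqF// mulr1.
by rewrite ltrDl.
Qed.

(** [L] is chosen before [x] and [g], so one barrier serves all solutions. Here [g] stands for the
    delayed term minus its value at equilibrium. *)
Lemma barrier_bound {R : realType} (alpha p kap tau e eta xs : R) :
  0 < alpha <= 1 -> 0 <= kap < p -> 0 <= tau -> 0 < eta < e ->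
  exists2 L, 0 < L & forall x g : R -> R,
    {within `[0, +oo[, continuous x} ->
    (forall t, 0 < t -> caputo_derivable alpha x t) ->
    (forall t, 0 < t -> caputo alpha x t = - p * (x t - xs) + g t) ->
    (forall t, 0 < t -> `|x (t - tau) - xs| <= e ->
      `|g t| <= kap * `|x (t - tau) - xs|) ->
    (forall t, - tau <= t <= 0 -> `|x t - xs| < e) ->
    forall t, 0 <= t -> `|x t - xs| < e - (e - eta) / L * Num.min t L.
Proof.
move=> al /andP[kap0 kapp] tau0 /andP[eta0 etae].
have [C C0 touch] := caputo_touch alpha al.
have ee0 : 0 <= e - eta by rewrite subr_ge0 ltW.
have dlt : 0 < (p - kap) * eta by rewrite mulr_gt0 ?subr_gt0.
have [L L0 HL] := barrier_slope_small alpha _ _ _ al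
  (mulr_ge0 ee0 C0) (mulr_ge0 ee0 (mulr_ge0 kap0 tau0)) dlt.
exists L => // x g cx dx eqx gx hist t t0.
pose k := (e - eta) / L; rewrite -/k.
have k0 : 0 <= k by rewrite divr_ge0// ltW.
have {}HL : k * C * L `^ (1 - alpha) + kap * (k * tau) < (p - kap) * eta.
  apply: le_lt_trans HL; rewrite powRB ?(gt_eqF L0) ?implybT//.
  rewrite powRr1 ?(ltW L0)// powRN /k le_eqVlt; apply/orP; left; apply/eqP.
  field; rewrite (gt_eqF L0) gt_eqF//; exact: powR_gt0.
have kL : k * L = e - eta by rewrite /k divfK// gt_eqF.
pose W s := e - k * Num.min s L; rewrite -/(W t).
pose f s := `|x s - xs| - W s.
rewrite ltNge; apply/negP => Wt.
have [|||T T0 [fT fs]] := @first_zero R f.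
- move=> z; apply: cvgB.
    by apply: cvg_norm; apply: cvgB; [exact: cx|exact: cvg_cst].
  apply: cvgB; first exact: cvg_cst.
  apply: cvgM; first exact: cvg_cst.
  apply: continuous_subspaceT z => z.
  by apply: continuous_min; [exact: cvg_id|exact: cvg_cst].
- rewrite /f /W (min_idPl (ltW L0)) mulr0 subr0 subr_lt0; apply: hist.
  by rewrite lexx oppr_le0 tau0.
- by exists t => //; rewrite /f subr_ge0.
have xT : `|x T - xs| = W T by apply/eqP; rewrite -subr_eq0; apply/eqP.
(* With this sign fixed, [sgm * (x s - xs)] is linear in [x], equals [W T] at [s = T], and is at
   most the absolute value at every [s]. *)
pose sgm := Num.sg (x T - xs).
have sgmT : sgm * (x T - xs) = W T by rewrite -xT /sgm -normrEsg.
have sgm_le y : sgm * y <= `|y|.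
  rewrite (le_trans (ler_norm _))// normrM ler_piMl// /sgm normr_sg.
  by case: (_ != 0).
have We s : 0 <= s -> W s <= e.
  by move=> s0; rewrite /W gerBl mulr_ge0// le_min s0 ltW.
have WT : eta <= W T.
  rewrite /W lerBrDr -lerBrDl -kL ler_wpM2l//.
  by rewrite ge_min lexx orbT.
(* The delayed value is bounded by the history if [T <= tau], and otherwise by the barrier at
   [T - tau]; over one delay the barrier falls by at most [k * tau]. *)
have [xtau_e xtau_W] : `|x (T - tau) - xs| <= e /\ `|x (T - tau) - xs| <= W T + k * tau.
  have [Ttau|Ttau] := leP (T - tau) 0.
    have xe : `|x (T - tau) - xs| < e.
      by apply: hist; rewrite Ttau andbT lerDr ltW.
    split; first exact: ltW.
    rewrite (le_trans (ltW xe))// /W -addrA lerDl addrC -mulrBr mulr_ge0//.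
    by rewrite subr_ge0 ge_min -subr_le0 Ttau.
  have xW : `|x (T - tau) - xs| <= W (T - tau).
    (* For [tau = 0] the delayed time is the touching time itself, where equality holds. *)
    rewrite -subr_le0 -/(f _); have [->|tau_ne0] := eqVneq tau 0.
      by rewrite subr0 fT.
    by apply/ltW/fs; rewrite ltW//= ltrBlDr ltrDl lt_neqAle eq_sym tau_ne0.
  split; first by rewrite (le_trans xW)// We// ltW.
  have minD : Num.min T L - tau <= Num.min (T - tau) L.
    rewrite le_min lerD2r ge_min lexx/= lerBlDr.
    by rewrite (@le_trans _ _ L) ?lerDl ?ge_min ?lexx ?orbT.
  rewrite (le_trans xW)// /W -addrA lerD2l lerNl opprD opprK -mulrBr.
  by rewrite ler_wpM2l.
have := touch x sgm k L T k0 L0 T0 (dx T T0) _.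
rewrite eqx// mulrDr mulrCA sgmT.
have gT : sgm * g T <= kap * (W T + k * tau).
  by rewrite (le_trans (sgm_le _))// (le_trans (gx T T0 xtau_e))// ler_wpM2l.
have pW : (p - kap) * eta <= (p - kap) * W T by rewrite ler_wpM2l// subr_ge0 ltW.
move=> H; have /H : forall s, 0 <= s <= T ->
    - k * (Num.min T L - Num.min s L) <= sgm * (x T - x s).
  move=> s /andP[s0 sT].
  have xs_le : sgm * (x s - xs) <= W s.
    rewrite (le_trans (sgm_le _))// -subr_le0 -/(f s).
    have [->|sneT] := eqVneq s T; first by rewrite fT.
    by apply/ltW/fs; rewrite s0 lt_neqAle sneT.
  rewrite (_ : x T - x s = (x T - xs) - (x s - xs)); last by ring.
  rewrite (_ : - k * _ = W T - W s); last by rewrite /W; ring.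
  by rewrite mulrBr sgmT lerB.
(* The lower bound from [touch] and the upper bound from [gT] and [pW] are incompatible with
   [HL]. *)
rewrite !mulrBl !mulrDr in gT pW HL * => {}H.
clear -HL gT pW H; lra.
Qed.

(** * Stability of the Mackey-Glass equilibrium *)

Lemma mg_equilibrium {R : realType} (alpha p q r xs tau : R) :
  0 < p -> 0 < q -> rpow_defined xs r -> rpow xs r = (q - p) / p ->
  is_equilibrium alpha p q r tau xs.
Proof.
move=> p0 q0 xsd xsr.
have g1 : 1 + rpow xs r = q / p by rewrite xsr; field; rewrite gt_eqF.
have d0 : derive1 (cst xs : R -> R) = cst 0 by apply/funext => t; rewrite derive1_cst.
have K0 t : caputo_kernel alpha (cst xs) t = cst 0.
  by apply/funext => s; rewrite /caputo_kernel d0 mulr0.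
split => //= [|t t0|t t0|t t0].
- by apply: continuous_subspaceT; exact: cst_continuous.
- by split => //; rewrite g1 mulf_neq0 ?invr_eq0 ?gt_eqF.
- rewrite /caputo_derivable; case: ifPn => _; first exact: derivable_cst.
  rewrite K0 /abs_continuous d0; split; last exact: integrable0.
  split; first exact: integrable0.
  by move=> s _; rewrite Rintegral_cst ?mul0r ?addr0//; exact: measurable_itv.
rewrite /caputo d0 K0 g1; have -> : - p * xs + q * (xs / (q / p)) = 0.
  by field; rewrite (gt_eqF p0) (gt_eqF q0).
case: ifPn => // _.
by rewrite Rintegral_cst ?mul0r ?mulr0//; exact: measurable_itv.
Qed.

Lemma history_norm_lt {R : realType} (tau b : R) (phi : R -> R) t :
  (history_norm tau phi < b%:E)%E -> - tau <= t <= 0 -> `|phi t| < b.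
Proof.
move=> phib tt; rewrite -lte_fin; apply: le_lt_trans phib.
by apply: ereal_sup_ubound; exists t => //=; rewrite in_itv.
Qed.

(** Small [e] will give stability, and fixed [e] with arbitrarily small [eta] will give
    attraction. *)
Lemma mg_barrier_bound {R : realType} (alpha p q r xs tau : R) :
  0 < alpha <= 1 -> 0 < p < q -> 0 < r -> 0 <= tau ->
  rpow_defined xs r -> rpow xs r = (q - p) / p -> 1 - 2 / r < p / q ->
  exists2 e0, 0 < e0 & forall e eta, 0 < eta < e -> e <= e0 ->
    exists2 L, 0 < L & forall phi x, is_solution alpha p q r tau phi x ->
      (history_norm tau (fun t => (phi t - xs)%R) < e%:E)%E ->
      forall t, 0 <= t -> `|x t - xs| < e - (e - eta) / L * Num.min t L.
Proof.
move=> al /andP[p0 pq] r0 tau0 xsd xsr hpq.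
have [kap [d d0 [kapp lip]]] := mg_feedback_lipschitz _ _ _ _ p0 pq r0 xsd xsr hpq.
(* Halving puts the closed ball of radius [e] inside the open ball where [lip] holds. *)
exists (d / 2); first by rewrite divr_gt0.
move=> e eta etae ed.
have [L L0 bound] := barrier_bound alpha p kap tau e eta xs al kapp tau0 etae.
exists L => // phi x [xphi cx _ dx eqx] hist.
apply: (bound x (fun t => q * (x (t - tau) / (1 + rpow (x (t - tau)) r)) - p * xs)) => //.
- by move=> t t0; rewrite eqx//; ring.
- move=> t t0 xe; apply: lip; apply: le_lt_trans xe _; apply: le_lt_trans ed _.
  by rewrite ltr_pdivrMr// ltr_pMr// ltr1n.
- by move=> t tt; rewrite xphi//; exact: (history_norm_lt tau e (fun t => phi t - xs) t hist tt).
Qed.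

Theorem theorem3p2 (R : realType) (alpha p q r xs : R)
  (alpha_gt0 : 0 < alpha) (alpha_le1 : alpha <= 1)
  (p_gt0 : 0 < p) (q_gt0 : 0 < q) (r_gt0 : 0 < r) (p_lt_q : p < q)
  (xs_defined : rpow_defined xs r) (xs_root : rpow xs r = (q - p) / p)
  (hpq : p / q > 1 - 2 / r) :
  forall tau : R, 0 <= tau -> asymptotically_stable alpha p q r tau xs.
Proof.
move=> tau tau0.
have alpha01 : 0 < alpha <= 1 by rewrite alpha_gt0.
have p0q : 0 < p < q by rewrite p_gt0.
have [e0 e0_gt0 barrier] :=
  mg_barrier_bound _ _ _ _ _ _ alpha01 p0q r_gt0 tau0 xs_defined xs_root hpq.
split; first exact: mg_equilibrium.
(* The barrier never exceeds its initial height [e'], which serves as [d]; the final level [e' / 2]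
   is an arbitrary choice. *)
- move=> e e_gt0; pose e' := Num.min e e0.
  have e'_gt0 : 0 < e' by rewrite lt_min e_gt0.
  have half : 0 < e' / 2 < e' by rewrite divr_gt0//= ltr_pdivrMr// ltr_pMr// ltr1n.
  have e'_le : e' <= e0 by rewrite ge_min lexx orbT.
  have [L L0 bound] := barrier e' (e' / 2) half e'_le.
  exists e' => // phi x solx hist t t0.
  apply: (lt_le_trans (bound phi x solx hist t t0)).
  have [_ /ltW half_le] := andP half.
  rewrite (@le_trans _ _ e') ?ge_min ?lexx// gerBl mulr_ge0//.
    by rewrite divr_ge0 ?subr_ge0// ltW.
  by rewrite le_min t0 ltW.
exists e0 => // phi x solx hist; apply/cvgrPdist_lt => e e_gt0.
(* From time [L] on the barrier equals [eta], which is at most [e]; the other term keeps [eta] below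
   [e0]. *)
pose eta := Num.min e (e0 / 2).
have eta_itv : 0 < eta < e0.
  rewrite lt_min e_gt0 divr_gt0//= gt_min; apply/orP; right.
  by rewrite ltr_pdivrMr// ltr_pMr// ltr1n.
have [L L0 bound] := barrier e0 eta eta_itv (lexx e0).
near=> t.
have Lt : L <= t by near: t; apply: nbhs_pinfty_ge; rewrite num_real.
have := bound phi x solx hist t (le_trans (ltW L0) Lt).
rewrite (min_idPr Lt) divfK ?gt_eqF// subKr distrC.
by move=> /lt_le_trans; apply; rewrite ge_min lexx.
Unshelve. all: by end_near. Qed.
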